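(* Let $(X,d)$ be a metric space and $A$ and $B$ two nonempty subsets of $X$ such that $(A,B)$ satisfies property W-WUC. Assume that $A$ is complete and that $A$ is a Chebyshev set with respect to $B$. Let $T$ be a cyclic contraction on $A\cup B$. Then $T$ has a unique best proximity point $z$ in $A$, and the sequence $\{T^{2n}x\}$ converges to $z$ for every $x\in A$.
   Context: $\operatorname{dist}(A,B)=\inf\{d(x,y): x\in A,\ y\in B\}$, $\operatorname{dist}(x,A)=\inf\{d(x,y):y\in A\}$, and $P_A(x)=\{y\in A: d(x,y)=\operatorname{dist}(x,A)\}$. The set $A$ is a Chebyshev set with respect to $B$ if $P_A(x)$ is a singleton for every $x\in B$. The pair $(A,B)$ has property W-WUC if every sequence $\{x_n\}\subseteq A$ with the following property has a convergent subsequence (in $X$): for every $\varepsilon>0$ there exist $y\in B$ and $n_0\in\mathbb N$ such that $d(x_n,y)\le\operatorname{dist}(A,B)+\varepsilon$ for all $n\ge n_0$. $T:A\cup B\to A\cup B$ is a cyclic contraction if $T(A)\subseteq B$, $T(B)\subseteq A$, and there is $r\in(0,1)$ such that $d(Tx,Ty)\le r\,d(x,y)+(1-r)\operatorname{dist}(A,B)$ for all $x\in A$, $y\in B$. A point $x\in A\cup B$ is a best proximity point for $T$ if $d(x,Tx)=\operatorname{dist}(A,B)$. *)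

(* Defs.v *)
From mathcomp Require Import all_boot all_order all_algebra.
From mathcomp Require Import all_classical all_reals all_analysis.

Set Implicit Arguments.
Unset Strict Implicit.
Unset Printing Implicit Defensive.

Import Order.TTheory GRing.Theory Num.Theory.

Local Open Scope classical_set_scope.
Local Open Scope ring_scope.

(* [inf] is the real-valued infimum: it is the mathematical one only when the
   sets involved are nonempty. *)
Definition set_dist (R : realType) (X : metricType R) (A B : set X) : R :=
  inf [set mdist x y | x in A & y in B].

Definition point_dist (R : realType) (X : metricType R) (x : X) (A : set X)
    : R :=
  inf [set mdist x y | y in A].

Definition metric_proj (R : realType) (X : metricType R) (A : set X) (x : X)
    : set X :=
  [set y | A y /\ mdist x y = point_dist x A].

Definition chebyshev_wrt (R : realType) (X : metricType R) (A B : set X)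
    : Prop :=
  forall x, B x -> exists y, metric_proj A x = [set y].

Definition complete_subset (R : realType) (X : metricType R) (A : set X)
    : Prop :=
  forall u : nat -> X, (forall n, A (u n)) -> cauchy (u @ \oo) ->
    exists2 l, A l & u @ \oo --> l.

(* The limit of the subsequence is taken in the whole space [X]. *)
Definition W_WUC (R : realType) (X : metricType R) (A B : set X) : Prop :=
  forall u : nat -> X, (forall n, A (u n)) ->
    (forall e : R, 0 < e -> exists y, exists n0 : nat,
       B y /\ forall n, (n0 <= n)%N -> mdist (u n) y <= set_dist A B + e) ->
    exists2 phi : nat -> nat, {homo phi : m n / (m < n)%N} &
      exists l : X, (u \o phi) @ \oo --> l.

(* A map of [A `|` B] to itself is represented by a map on [X] whose values
   outside [A `|` B] are irrelevant; the two inclusions make it stabilise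
   [A `|` B]. *)
Definition cyclic_contraction (R : realType) (X : metricType R) (A B : set X)
    (T : X -> X) : Prop :=
  [/\ T @` A `<=` B, T @` B `<=` A &
    exists2 r : R, 0 < r < 1 &
      forall x y, A x -> B y ->
        mdist (T x) (T y) <= r * mdist x y + (1 - r) * set_dist A B].

Definition best_proximity_point (R : realType) (X : metricType R)
    (A B : set X) (T : X -> X) (x : X) : Prop :=
  (A `|` B) x /\ mdist x (T x) = set_dist A B.

(* Main.v *)
(** Put [D = dist(A, B)] and [S = T^2]; the excess [d(x, y) - D] is multiplied
    by at most [r] under [T]. A one-step affine recursion bounds
    [d(S^k x, T x)], so [d(S^n x, S^m (T x)) <= D + r^(2m) M] for [m <= n], and
    W-WUC gives a cluster point [z] of [S^n x] in [A]. Letting [n] tend to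
    infinity along the subsequence, [d(z, S^m (T x))] tends to [D], hence so
    does [d(S^n x, T z)], and [d(z, T z) = D]. Since [P_A (T z)] is a
    singleton, W-WUC applied to subsequences upgrades this to convergence of
    the whole sequence [S^n x] to [z]. For best proximity points [w] and [z] in
    [A], the singleton property first gives [S w = w] and [S z = z], then
    [d(z, T w) = D] by contraction, and so [w = z]. *)

Require Import Defs.
From mathcomp Require Import all_boot all_order all_algebra.
From mathcomp Require Import all_classical all_reals all_analysis.
From mathcomp Require Import lra.

Import Order.TTheory GRing.Theory Num.Theory.

Set Implicit Arguments.
Unset Strict Implicit.

Local Open Scope classical_set_scope.
Local Open Scope ring_scope.

Lemma cvgn_mdistP (R : realType) (X : metricType R) (u : nat -> X) (l : X) :
  u @ \oo --> l <->
  forall e : R, 0 < e ->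
    exists N : nat, forall n, (N <= n)%N -> mdist (u n) l <= e.
Proof.
split=> [/metricType_numDomainType.cvgrPdist_le ul e e0|ul].
  by have [N _ Nu] := ul _ e0; exists N => n Nn; rewrite metric_sym Nu.
apply/metricType_numDomainType.cvgrPdist_le => e e0.
by have [N Nu] := ul _ e0; exists N => // n Nn; rewrite metric_sym Nu.
Qed.

Lemma cvgn_mdist_le (R : realType) (X : metricType R) (u : nat -> X)
    (l y : X) (c : R) :
  u @ \oo --> l -> (exists N : nat, forall n, (N <= n)%N -> mdist (u n) y <= c) ->
  mdist l y <= c.
Proof.
move=> /cvgn_mdistP ul [N uy]; apply/ler_addgt0Pr => e e0.
have [M uM] := ul e e0; pose n := maxn N M.
have := metric_triangle l (u n) y; rewrite (metric_sym l (u n)).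
by have := uM n (leq_maxr _ _); have := uy n (leq_maxl _ _); lra.
Qed.

Lemma leq_homo_ltn (phi : nat -> nat) (n : nat) :
  {homo phi : i j / (i < j)%N} -> (n <= phi n)%N.
Proof. by move=> phiS; elim: n => // n /leq_ltn_trans; apply; apply: phiS. Qed.

Lemma set_dist_le (R : realType) (X : metricType R) (A B : set X) (x y : X) :
  A x -> B y -> set_dist A B <= mdist x y.
Proof.
move=> Ax By; apply: ge_inf; last by exists x => //; exists y.
by exists 0 => _ [a _ [b _ <-]]; exact: mdist_ge0.
Qed.

(** Since [y] lies in [B], no point of [A] is closer to it than [set_dist A B]; a point of [A]
    within that distance is therefore nearest. *)
Lemma metric_proj_set_dist (R : realType) (X : metricType R) (A B : set X)
    (x y : X) :
  A x -> B y -> mdist x y <= set_dist A B -> metric_proj A y x.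
Proof.
move=> Ax By xy; split=> //; apply/eqP; rewrite eq_le; apply/andP; split.
  apply: lb_le_inf; first by exists (mdist y x), x.
  move=> _ [a Aa <-]; rewrite metric_sym (le_trans xy)// metric_sym.
  exact: set_dist_le.
apply: ge_inf; last by exists x.
by exists 0 => _ [a _ <-]; exact: mdist_ge0.
Qed.

Lemma chebyshev_eq (R : realType) (X : metricType R) (A B : set X)
    (a b y : X) :
  chebyshev_wrt A B -> A a -> A b -> B y ->
  mdist a y <= set_dist A B -> mdist b y <= set_dist A B -> a = b.
Proof.
move=> chebA Aa Ab By /(metric_proj_set_dist Aa By) ay.
move=> /(metric_proj_set_dist Ab By).
by have [p projp] := chebA y By; rewrite projp in ay * => ->.
Qed.

(** A convergent sequence is Cauchy, so completeness gives a limit in [A], equal to [l] by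
    separation. This puts into [A] the limits that W-WUC only places in [X]. *)
Lemma complete_subset_cvg (R : realType) (X : metricType R) (A : set X)
    (u : nat -> X) (l : X) :
  complete_subset A -> (forall n, A (u n)) -> u @ \oo --> l -> A l.
Proof.
move=> cA Au ul; have [|k Ak uk] := cA u Au; last first.
  by rewrite (cvg_unique (@metric_hausdorff _ _) ul uk).
apply: cauchy_exP => e e0; exists l.
by move/cvg_ballP: ul; exact.
Qed.

Lemma W_WUC_subseq (R : realType) (X : metricType R) (A B : set X)
    (u : nat -> X) :
  W_WUC A B -> complete_subset A -> (forall n, A (u n)) ->
  (forall e : R, 0 < e -> exists y, exists n0 : nat,
     B y /\ forall n, (n0 <= n)%N -> mdist (u n) y <= set_dist A B + e) ->
  exists phi : nat -> nat, exists l : X,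
    [/\ forall n, (n <= phi n)%N, A l & (u \o phi) @ \oo --> l].
Proof.
move=> wAB cA Au uB; have [phi phiS [l ul]] := wAB u Au uB.
exists phi, l; split=> //; first by move=> n; exact: leq_homo_ltn.
by apply: complete_subset_cvg ul => // n; exact: Au.
Qed.

(* Applied with the constant point [y], W-WUC makes every subsequence of [u]
   cluster at a point of [P_A y], which is a singleton. *)
Lemma W_WUC_cvg (R : realType) (X : metricType R) (A B : set X)
    (u : nat -> X) (y z : X) :
  W_WUC A B -> complete_subset A -> chebyshev_wrt A B ->
  (forall n, A (u n)) -> B y ->
  (forall e : R, 0 < e -> exists N : nat,
     forall n, (N <= n)%N -> mdist (u n) y <= set_dist A B + e) ->
  A z -> mdist z y <= set_dist A B -> u @ \oo --> z.
Proof.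
move=> wAB cA chebA Au By uy Az zy; apply/cvgn_mdistP => e e0.
apply: contrapT => Nuz.
(* [g N] is an index at least [N] where [u] is farther than [e] from [z]. It need not be monotone:
   [N <= g N] suffices below. *)
have /choice[g gP] N : exists n, (N <= n)%N /\ e < mdist (u n) z.
  apply: contrapT => h; apply: Nuz; exists N => n Nn.
  by rewrite leNgt; apply/negP => enz; apply: h; exists n.
have vy d : 0 < d -> exists N : nat,
    forall n, (N <= n)%N -> mdist (u (g n)) y <= set_dist A B + d.
  move=> /uy[N Nu]; exists N => n Nn.
  by apply: Nu; apply: leq_trans Nn _; have [] := gP n.
have [||phi [l [phi_ge Al vl]]] := @W_WUC_subseq _ _ _ _ (u \o g) wAB cA.
- by move=> n; exact: Au.
- by move=> d /vy[N Nu]; exists y, N.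
have ly : mdist l y <= set_dist A B.
  apply/ler_addgt0Pr => d /vy[N Nu]; apply: cvgn_mdist_le vl _.
  by exists N => n Nn; apply: Nu; exact: leq_trans Nn (phi_ge n).
have lz := chebyshev_eq chebA Al Az By ly zy.
move: vl; rewrite lz => /cvgn_mdistP/(_ _ e0)[N /(_ N (leqnn N))] /=.
by rewrite leNgt; have [_ ->] := gP (phi N).
Qed.

Lemma affine_rec_bounded (R : realType) (q c : R) (b : nat -> R) :
  0 <= q < 1 -> (forall n, b n.+1 <= q * b n + c) ->
  exists2 M, 0 < M & forall n, b n <= M.
Proof.
(* [K] dominates the fixed point [c / (1 - q)] of the affine map, so every upper bound above [K] is
   preserved by the recursion. The summand 1 below only makes the bound positive. *)
move=> /andP[q0 q1] bS; pose K := `|c| / (1 - q).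
have q1' : 0 < 1 - q by rewrite subr_gt0.
have K0 : 0 <= K by rewrite divr_ge0 // ltW.
have Kc : c <= K * (1 - q) by rewrite divfK ?gt_eqF ?ler_norm.
exists (1 + `|b 0| + K) => [|n]; first by have := normr_ge0 (b 0); lra.
have b0 := normr_ge0 (b 0).
elim: n => [|n IHn]; first by have := ler_norm (b 0); lra.
have := ler_wpM2l q0 IHn; have := bS n.
have : 0 <= (1 - q) * (1 + `|b 0|) by rewrite mulr_ge0 //; lra.
by lra.
Qed.

Lemma geometric_le (R : realType) (q M e : R) :
  0 <= q < 1 -> 0 < M -> 0 < e ->
  exists N : nat, forall n, (N <= n)%N -> q ^+ n * M <= e.
Proof.
move=> /andP[q0 q1] M0 e0.
have : `|q| < 1 by rewrite ger0_norm.
move=> /cvg_expr/cvgrPdist_le/(_ (e / M)); rewrite divr_gt0 // => /(_ isT).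
move=> [N _ Nq]; exists N => n /Nq /=.
by rewrite sub0r normrN ger0_norm ?exprn_ge0 // ler_pdivlMr.
Qed.

Lemma iter_closed (X : Type) (A : set X) (S : X -> X) (x : X) (n : nat) :
  (forall y, A y -> A (S y)) -> A x -> A (iter n S x).
Proof. by move=> SA Ax; elim: n => //= n; exact: SA. Qed.

Section relative_contraction.
Context (R : realType) (X : metricType R) (A B : set X) (S : X -> X) (q : R).
Local Notation D := (set_dist A B).
Hypothesis (q01 : 0 <= q < 1).
Hypothesis (SA : forall x, A x -> A (S x)) (SB : forall y, B y -> B (S y)).
Hypothesis S_contr : forall x y, A x -> B y ->
  mdist (S x) (S y) - D <= q * (mdist x y - D).

Lemma iter_contr x y n : A x -> B y ->
  mdist (iter n S x) (iter n S y) - D <= q ^+ n * (mdist x y - D).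
Proof.
move=> Ax By; have /andP[q0 _] := q01.
elim: n => [|n IHn]; first by rewrite expr0 mul1r.
rewrite !iterS exprS -mulrA.
apply: le_trans (ler_wpM2l q0 IHn).
exact: S_contr (iter_closed _ SA Ax) (iter_closed _ SB By).
Qed.

(** For fixed [y], the triangle inequality through [S y] gives the excess of [mdist (iter n S x) y]
    an affine recursion, hence a bound [M]. Applying [S] to the pair [iter (n - m) S x], [y] another
    [m] times contributes the factor [q ^+ m]. *)
Lemma iter_excess x y : A x -> B y ->
  exists2 M, 0 < M & forall m n, (m <= n)%N ->
    mdist (iter n S x) (iter m S y) <= D + q ^+ m * M.
Proof.
move=> Ax By; have /andP[q0 _] := q01.
have [|M M0 bM] := @affine_rec_bounded _ q (mdist (S y) y)
  (fun n => mdist (iter n S x) y - D) q01.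
  move=> n; have := S_contr (iter_closed n SA Ax) By.
  have := metric_triangle (iter n.+1 S x) (S y) y; rewrite iterS; lra.
exists M => // m n mn; rewrite -lerBlDl -(subnKC mn) iterD.
apply: le_trans (iter_contr _ (iter_closed _ SA Ax) By) _.
by rewrite ler_wpM2l ?exprn_ge0.
Qed.

End relative_contraction.

Unset Implicit Arguments.

Theorem theorem3p22 (R : realType) (X : metricType R) (A B : set X)
    (A_neq0 : A !=set0) (B_neq0 : B !=set0)
    (AB_WWUC : W_WUC A B)
    (A_complete : complete_subset A)
    (A_chebyshev : chebyshev_wrt A B)
    (T : X -> X) (T_cyclic : cyclic_contraction A B T) :
  exists z : X,
    [/\ A z,
        best_proximity_point A B T z,
        (forall w : X, A w -> best_proximity_point A B T w -> w = z) &
        forall x : X, A x -> (fun n : nat => iter (2 * n)%N T x) @ \oo --> z].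
Proof.
have [TAB TBA [r /andP[r0 r1] T_contr]] := T_cyclic.
have TA x : A x -> B (T x) by move=> Ax; apply: TAB; exists x.
have TB x : B x -> A (T x) by move=> Bx; apply: TBA; exists x.
pose D := set_dist A B; pose S x := T (T x); pose q := r * r.
have T_excess x y : A x -> B y -> mdist (T x) (T y) - D <= r * (mdist x y - D).
  by move=> Ax By; have := T_contr _ _ Ax By; rewrite -/D; lra.
have T_le x y (e : R) : A x -> B y -> 0 <= e -> mdist x y <= D + e ->
    mdist (T x) (T y) <= D + e.
  move=> Ax By e0 xy; have := T_excess _ _ Ax By.
  have := set_dist_le Ax By; rewrite -/D => Dxy.
  have : 0 <= (1 - r) * (mdist x y - D).
    by rewrite mulr_ge0 ?subr_ge0 ?(ltW r1).
  by lra.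
have q01 : 0 <= q < 1 by rewrite mulr_ge0 ?mulr_ilt1 // ltW.
have SA x : A x -> A (S x) by move=> /TA/TB.
have SB y : B y -> B (S y) by move=> /TB/TA.
have S_excess x y : A x -> B y ->
    mdist (S x) (S y) - D <= q * (mdist x y - D).
  move=> Ax By; rewrite (metric_sym (S x)) -mulrA.
  apply: le_trans (T_excess _ _ (TB _ By) (TA _ Ax)) _.
  by rewrite ler_wpM2l ?(ltW r0) // (metric_sym (T y)) T_excess.
have iterTS x n : iter (2 * n)%N T x = iter n S x by rewrite mulnC iterM.
(* Both [w] and [S w] lie at distance [D] from [T w], which has a single nearest point in [A]. *)
have S_fix w : A w -> mdist w (T w) <= D -> S w = w.
  move=> Aw wTw; apply: (@chebyshev_eq _ _ _ _ _ _ (T w) A_chebyshev) => //.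
  - exact: SA.
  - exact: TA.
  - rewrite metric_sym -[leRHS]addr0; apply: T_le; rewrite ?addr0//; exact: TA.
have uniq_bpp w z : A w -> A z -> mdist w (T w) <= D -> mdist z (T z) <= D ->
    w = z.
  move=> Aw Az wTw zTz.
  apply: (@chebyshev_eq _ _ _ _ _ _ (T w) A_chebyshev) => //; first exact: TA.
  (* As [S] fixes both [z] and [T w], the excess [t] of [mdist z (T w)] over [D] satisfies
     [t <= q * t] with [q < 1], so [t <= 0]. *)
  have := S_excess _ _ Az (TA _ Aw); rewrite (S_fix z) //.
  rewrite [S (T w)](_ : _ = T w); last by rewrite -{2}(S_fix w).
  move=> zTw; have /andP[_ q1] := q01; rewrite -/D -subr_le0.
  by rewrite -(pmulr_rle0 _ (_ : 0 < 1 - q)); lra.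
have orbit x : A x -> exists z,
    [/\ A z, mdist z (T z) <= D & (fun n => iter n S x) @ \oo --> z].
  move=> Ax; have [M M0 xM] :=
    iter_excess q01 SA SB S_excess Ax (TA _ Ax).
  have Ax_ n : A (iter n S x) by exact: iter_closed.
  have Bx_ n : B (iter n S (T x)) by apply: iter_closed => //; exact: TA.
  have [|phi [z [phi_ge Az xz]]] :=
      W_WUC_subseq AB_WWUC A_complete Ax_.
    move=> e /(geometric_le q01 M0)[N qN].
    (* The point of [B] depends on [e]: once [q ^+ N * M <= e], [iter N S (T x)] serves all later
       [n]. *)
    exists (iter N S (T x)), N; split=> // n Nn.
    by apply: le_trans (xM _ _ Nn) _; rewrite lerD2l qN.
  have zM m : mdist z (iter m S (T x)) <= D + q ^+ m * M.
    apply: cvgn_mdist_le xz _; exists m => n mn /=.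
    exact/xM/(leq_trans mn).
  have xTz e : 0 < e -> exists N : nat, forall n, (N <= n)%N ->
      mdist (iter n S x) (T z) <= D + e.
    move=> e0; have [N qN] := geometric_le q01 M0 e0.
    (* The shift by one comes from applying [T] to the pair [z], [iter n S (T x)]: since [T]
       commutes with [S], the second point becomes [iter n.+1 S x]. *)
    exists N.+1 => -[//|n] Nn.
    rewrite metric_sym iterS /S -[T (iter n S x)](_ : iter n S (T x) = _).
      by apply: T_le; rewrite ?(ltW e0)// (le_trans (zM n))// lerD2l qN.
    by elim: (n) => //= k ->.
  have zTz : mdist z (T z) <= D.
    apply/ler_addgt0Pr => e /xTz[N xN]; apply: cvgn_mdist_le xz _.
    by exists N => n Nn; apply: xN; exact: leq_trans Nn (phi_ge n).
  exists z; split=> //.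
  exact: W_WUC_cvg AB_WWUC A_complete A_chebyshev Ax_ (TA _ Az) xTz Az zTz.
(* A priori each orbit has its own limit; one orbit supplies [z], and [uniq_bpp] identifies the
   other limits with it. *)
have [x0 Ax0] := A_neq0; have [z [Az zTz _]] := orbit x0 Ax0.
exists z; split=> //.
- split; first by left.
  by apply/eqP; rewrite eq_le zTz; apply: set_dist_le => //; exact: TA.
- by move=> w Aw [_ wTw]; apply: uniq_bpp; rewrite // wTw.
- move=> x Ax; have [z' [Az' z'Tz' xz']] := orbit x Ax.
  rewrite (uniq_bpp _ _ Az Az' zTz z'Tz').
  by under eq_fun do rewrite iterTS.
Qed.
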